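(* There is a bijection $\Phi:\mathcal{G}\to\mathcal{M}$ such that, for every $G\in\mathcal{G}$, the bubbles of $G$ correspond to the square-vertices of $\Phi(G)$, the faces of color 1 (resp. color 2) of $G$ correspond to the faces of the map $\Phi(G)^{(1)}$ (resp. $\Phi(G)^{(2)}$), and the faces of color 3 of $G$ correspond to the black vertices of $\Phi(G)$. In particular $G$ and $\Phi(G)$ have the same number of bubbles/square-vertices and $F(G)=F(\Phi(G))$.
   Context: Colored graphs: a colored graph is a finite bipartite graph (black and white vertices), 4-regular, whose edges carry colors in $\{0,1,2,3\}$ so that each vertex is incident to exactly one edge of each color. Let $B$ be the colored graph (without color 0) on white vertices $1_\circ,2_\circ,3_\circ,4_\circ$ and black vertices $1_\bullet,\dots,4_\bullet$ whose edges are: color 3: $i_\circ i_\bullet$ for $i=1,\dots,4$; color 1: $1_\circ 2_\bullet, 2_\circ 1_\bullet, 3_\circ 4_\bullet, 4_\circ 3_\bullet$; color 2: $1_\circ 4_\bullet, 4_\circ 1_\bullet, 2_\circ 3_\bullet, 3_\circ 2_\bullet$ (this is the graph dual to an octahedron made of eight colored tetrahedra). A bubble of a colored graph is a maximal connected subgraph using only colors 1, 2, 3. $\mathcal{G}$ is the set of connected colored graphs all of whose bubbles are isomorphic (as edge-colored bipartite graphs) to $B$, considered up to color-preserving isomorphism; equivalently, connected graphs obtained from finitely many copies of $B$ by adding color-0 edges forming a perfect matching between white and black vertices. For $a\in\{1,2,3\}$, a face of color $a$ of $G$ is a cycle of $G$ whose edges alternate between colors 0 and $a$; $F(G)$ is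 the total number of faces of colors 1, 2, 3. The set $\mathcal{M}$: an element $M\in\mathcal{M}$ is a connected graph made of (i) square-vertices: cycles of length four whose edges (''inner edges'') are colored alternately $1,2,1,2$ and whose vertices are called inner vertices; (ii) black vertices of arbitrary finite degree, each equipped with a cyclic ordering of its incident edges; (iii) edges (distinct from inner edges), each joining a black vertex to an inner vertex, such that every inner vertex is incident to exactly one such edge. Elements are taken up to isomorphisms preserving colors and cyclic orders. For $c\in\{1,2\}$, $M^{(c)}$ is the combinatorial map obtained from $M$ by deleting all inner edges of the color other than $c$, then erasing each (now bivalent) inner vertex and merging its edge with its inner edge; its vertices are the black vertices of $M$ with the induced cyclic orders (if $M$ has $b$ square-vertices, $M^{(c)}$ has $2b$ edges). Faces of $M^{(c)}$ are the usual faces of a combinatorial map (an isolated vertex has one face). The faces of $M$ are the faces of $M^{(1)}$, the faces of $M^{(2)}$ and the black vertices of $M$; $F(M)$ denotes their total number.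
   Formalization: Elements of M are required to have at least one square-vertex; this excludes only the single isolated black vertex, which has no square and three faces and so corresponds to no graph in G. *)

(* Defs.v *)
From mathcomp Require Import all_boot fingroup perm.
From mathcomp Require Import boolp classical_sets functions.

Set Implicit Arguments.
Unset Strict Implicit.
Unset Printing Implicit Defensive.

Local Open Scope set_scope.

Definition connected_graph (T : finType) (r : rel T) : Prop :=
  0 < #|T| /\ forall x y, connect r x y.

Definition color := 'I_4.
Definition c0 : color := @Ordinal 4 0 isT.
Definition c1 : color := @Ordinal 4 1 isT.
Definition c2 : color := @Ordinal 4 2 isT.
Definition c3 : color := @Ordinal 4 3 isT.

(* Edge-colored bipartite multigraphs; parallel edges are allowed, even of the
   same color unless [colored_graph] is assumed. *)
Record bigraph := BiGraph {
  white : finType;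
  black : finType;
  gedge : finType;
  wend : gedge -> white;
  bend : gedge -> black;
  gcolor : gedge -> color
}.

Definition bigraph_iso (G H : bigraph) : Prop :=
  exists (f : white G -> white H) (g : black G -> black H)
         (h : gedge G -> gedge H),
    [/\ bijective f, bijective g, bijective h &
      forall e, [/\ wend (h e) = f (wend e), bend (h e) = g (bend e)
                  & gcolor (h e) = gcolor e]].

Definition colored_graph (G : bigraph) : Prop :=
  (forall (x : white G) (c : color),
     #|[set e : gedge G | (wend e == x) && (gcolor e == c)]| = 1) /\
  (forall (y : black G) (c : color),
     #|[set e : gedge G | (bend e == y) && (gcolor e == c)]| = 1).

Section ColoredGraph.
Variable G : bigraph.

Definition vertex : finType := (white G + black G)%type.

Definition adj (P : {pred color}) : rel vertex := fun u v =>
  [exists e : gedge G, (gcolor e \in P) &&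
     (((u == inl (wend e)) && (v == inr (bend e))) ||
      ((v == inl (wend e)) && (u == inr (bend e))))].

(* A bubble is represented by its vertex set. *)
Definition bubbles : {set {set vertex}} :=
  equivalence_partition (connect (adj [pred c | c != c0])) [set: vertex].

Section BubbleGraph.
Variable S : {set vertex}.

Definition bubble_edge (e : gedge G) : bool :=
  [&& gcolor e != c0, inl (wend e) \in S & inr (bend e) \in S].

Lemma bubble_edgeW (e : {e | bubble_edge e}) : inl (wend (val e)) \in S.
Proof. by case: e => e /= /and3P[]. Qed.

Lemma bubble_edgeB (e : {e | bubble_edge e}) : inr (bend (val e)) \in S.
Proof. by case: e => e /= /and3P[]. Qed.

Definition bubble_graph : bigraph :=
  @BiGraph {x : white G | inl x \in S} {y : black G | inr y \in S}
    {e : gedge G | bubble_edge e}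
    (fun e => exist _ (wend (val e)) (bubble_edgeW e))
    (fun e => exist _ (bend (val e)) (bubble_edgeB e))
    (fun e => gcolor (val e)).

End BubbleGraph.

(* [f] follows [e] on a closed walk alternating between colors 0 and [a] and
   crossing the edges of color 0 from their white end to their black end, and
   those of color [a] from their black end to their white end.
   Bipartiteness allows every alternating cycle to be oriented this way. *)
Definition alternate (a : color) : rel (gedge G) := fun e f =>
  [&& gcolor e == c0, gcolor f == a & bend e == bend f] ||
  [&& gcolor e == a, gcolor f == c0 & wend e == wend f].

(* A face is represented by its edge set. *)
Definition faces (a : color) : {set {set gedge G}} :=
  [set C : {set gedge G} |
    `[< exists s : seq (gedge G),
          [/\ s != [::], ucycle (alternate a) s & C = [set:: s]] >]].

Definition nfaces : nat := #|faces c1| + #|faces c2| + #|faces c3|.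

End ColoredGraph.

(* The graph B: entry i of row k is the black end of the edge of color k + 1
   at the white vertex i, vertices being numbered from 0. *)
Definition octahedron_table : seq (seq nat) :=
  [:: [:: 1; 0; 3; 2];
      [:: 3; 2; 1; 0];
      [:: 0; 1; 2; 3]].

Definition octahedron : bigraph :=
  @BiGraph 'I_4 'I_4 ('I_3 * 'I_4)%type
    (fun e => e.2)
    (fun e => inord (nth 0 (nth [::] octahedron_table e.1) e.2))
    (fun e => lift ord0 e.1).

Definition octahedral (G : bigraph) : Prop :=
  [/\ colored_graph G, connected_graph (@adj G predT)
    & forall S, S \in bubbles G -> bigraph_iso (bubble_graph S) octahedron].

(* Combinatorial maps, possibly with isolated vertices. The darts are the
   half-edges, [copp] exchanges the two halves of an edge, and the cycles of
   [crot] are the cyclic orders around the vertices. A fixed point of [copp]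
   would be a dangling half-edge. *)
Record cmap := CMap {
  cvertex : finType;
  dart : finType;
  corigin : dart -> cvertex;
  crot : {perm dart};
  crotP : forall d d', (d' \in porbit crot d) = (corigin d' == corigin d);
  copp : dart -> dart;
  coppK : involutive copp
}.

Definition face_perm (N : cmap) : {perm dart N} :=
  (perm (inv_inj (@coppK N)) * crot N)%g.

(* [inl D] is the face whose darts are those of the orbit [D]; [inr v] is the
   single face of an isolated vertex [v]. *)
Definition pre_face (N : cmap) : finType := ({set dart N} + cvertex N)%type.

Definition map_faces (N : cmap) : {set pre_face N} :=
  [set F : pre_face N |
    match F with
    | inl D => D \in porbits (face_perm N)
    | inr v => ~~ [exists d : dart N, corigin d == v]
    end].

Definition on_map_face (N : cmap) (F : pre_face N) (d : dart N) : bool :=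
  if F is inl D then d \in D else false.

(* The inner vertices are the pairs (s, j) of a square s and j : 'I_4. The
   inner edges of s join (s, j) and (s, j + 1 mod 4), for j = 0, ..., 3. *)
Definition inner (S : finType) : finType := (S * 'I_4)%type.

Definition inner_color (j : 'I_4) : color := if odd j then c2 else c1.

(* The other end of the inner edge of color [c] at [u], or [u] itself if there
   is none, that is if c is neither 1 nor 2. *)
Definition across (S : finType) (c : color) (u : inner S) : inner S :=
  if inner_color u.2 == c then (u.1, ordS u.2)
  else if inner_color (ord_pred u.2) == c then (u.1, ord_pred u.2)
  else u.

Lemma acrossK (S : finType) c : involutive (@across S c).
Proof.
case=> s [j jlt]; rewrite /across /=.
by case: c => [[|[|[|[|c]]]] clt] //; case: j jlt => [|[|[|[|j]]]] jlt //=;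
  congr (_, _); apply: val_inj.
Qed.

(* [medge_at u] is the unique edge at the inner vertex [u]. A cyclic order on
   the edges at each black vertex is a permutation of the edges whose orbits
   are the sets of edges at a black vertex. *)
Record mgraph := MGraph {
  msquare : finType;
  mblack : finType;
  medge : finType;
  mtip : medge -> inner msquare;
  mfoot : medge -> mblack;
  medge_at : inner msquare -> medge;
  mtipK : cancel mtip medge_at;
  medge_atK : cancel medge_at mtip;
  mrot : {perm medge};
  mrotP : forall e e', (e' \in porbit mrot e) = (mfoot e' == mfoot e)
}.

Definition mgraph_iso (M N : mgraph) : Prop :=
  exists (f : inner (msquare M) -> inner (msquare N))
         (g : mblack M -> mblack N) (h : medge M -> medge N),
    [/\ bijective f, bijective g, bijective h,
        forall c u, c = c1 \/ c = c2 -> f (across c u) = across c (f u) &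
        forall e, [/\ mtip (h e) = f (mtip e), mfoot (h e) = g (mfoot e)
                    & mrot N (h e) = h (mrot M e)]].

Section MGraph.
Variable M : mgraph.

Definition mvertex : finType := (inner (msquare M) + mblack M)%type.

Definition madj : rel mvertex := fun x y =>
  match x, y with
  | inl u, inl v => (v == across c1 u) || (v == across c2 u)
  | inl u, inr b | inr b, inl u =>
      [exists e : medge M, (mtip e == u) && (mfoot e == b)]
  | inr _, inr _ => false
  end.

(* At least one square is required: this only excludes the graph reduced to an
   isolated black vertex, which has three faces and no square and hence no
   counterpart among the (nonempty) colored graphs. *)
Definition stuffed_map : Prop := connected_graph madj /\ 0 < #|msquare M|.

(* Each half-edge of M^(c) contains exactly one edge of M. *)
Definition mopp (c : color) (e : medge M) : medge M :=
  medge_at (across c (mtip e)).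

Lemma moppK c : involutive (mopp c).
Proof. by move=> e; rewrite /mopp medge_atK acrossK mtipK. Qed.

(* The map M^(c), for c = 1, 2. *)
Definition mmap (c : color) : cmap := CMap (@mrotP M) (@moppK c).

Definition mnfaces : nat :=
  #|map_faces (mmap c1)| + #|map_faces (mmap c2)| + #|mblack M|.

End MGraph.

(* Isomorphism classes, as predicates. [classical_sets.set] and its [set_bij]
   cannot be used here because of universe constraints: [bigraph] and [mgraph]
   quantify over finite types. *)
Definition calG : Type :=
  {C : bigraph -> Prop | exists2 G, octahedral G & C = bigraph_iso G}.

Definition calM : Type :=
  {D : mgraph -> Prop | exists2 M, stuffed_map M & D = mgraph_iso M}.

(* Throughout, [th] matches the white vertices of G -- equivalently its edges
   of color 3 -- with the edges of M -- equivalently its inner vertices. *)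
Section Correspondence.
Variables (G : bigraph) (M : mgraph) (th : white G -> medge M).

Definition bubbles_to_squares : Prop :=
  exists beta : {set vertex G} -> msquare M,
    set_bij [set` bubbles G]%classic [set: msquare M]%classic beta /\
    forall S x, S \in bubbles G -> inl x \in S -> beta S = (mtip (th x)).1.

Definition faces_to_map_faces (c : color) : Prop :=
  exists phi : {set gedge G} -> pre_face (mmap M c),
    set_bij [set` faces G c]%classic [set` map_faces (mmap M c)]%classic phi /\
    forall C e, C \in faces G c -> e \in C ->
      on_map_face (phi C) (th (wend e)).

Definition faces_to_black_vertices : Prop :=
  exists psi : {set gedge G} -> mblack M,
    set_bij [set` faces G c3]%classic [set: mblack M]%classic psi /\
    forall C e, C \in faces G c3 -> e \in C -> psi C = mfoot (th (wend e)).

End Correspondence.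

(* Main.v *)
Require Import Defs.
From mathcomp Require Import all_boot fingroup perm.
From mathcomp Require Import boolp classical_sets functions.

Set Implicit Arguments.
Unset Strict Implicit.
Unset Printing Implicit Defensive.

Local Open Scope set_scope.

(* An octahedral graph G is determined by its white vertices together with the
   permutations "cross from white to black along color c, come back along
   color 3". For c = 1, 2 these are involutions of which each bubble is a
   4-cycle, that is a square; for c = 0 the permutation is arbitrary, and its
   inverse is the rotation whose orbits are the black vertices of a stuffed map.
   In the map M^(c), the face permutation is then the inverse of "cross along
   color 0, come back along color c", whose orbits are the faces of color c.
   All this says that M is the stuffed map of G when G is isomorphic to a
   bigraph [graph_of M] with the edges of M as white and as black vertices. *)

(** * Bijections of finite types and transport of reachability *)

Lemma inj_surj_bij (T U : finType) (f : T -> U) :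
  injective f -> (forall y, exists x, f x = y) -> bijective f.
Proof.
move=> f_inj f_surj; apply: (inj_card_bij f_inj).
have <- : #|codom f| = #|U|.
  apply: eq_card => y; rewrite [RHS]inE; apply/codomP.
  by have [x <-] := f_surj y; exists x.
by rewrite card_codom.
Qed.

Lemma connect_homo (T U : finType) (r : rel T) (r' : rel U) (f : T -> U) :
    (forall x y, r x y -> connect r' (f x) (f y)) ->
  forall x y, connect r x y -> connect r' (f x) (f y).
Proof.
move=> rr' x y /connectP[p rp ->]; elim: p x rp => //= z p IHp x /andP[rxz rp].
exact: connect_trans (rr' _ _ rxz) (IHp _ rp).
Qed.

(** * Isomorphisms *)

Lemma bigraph_iso_refl G : bigraph_iso G G.
Proof. by exists id, id, id; split=> //; exists id. Qed.

Lemma bigraph_iso_sym G H : bigraph_iso G H -> bigraph_iso H G.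
Proof.
move=> [f [g [h [[f' fK f'K] [g' gK g'K] [h' hK h'K] fgh]]]].
exists f', g', h'; split; [by exists f | by exists g | by exists h | move=> e].
have [w b c] := fgh (h' e); rewrite h'K in w b c.
by split=> //; [rewrite w fK | rewrite b gK].
Qed.

Lemma bigraph_iso_trans G H K :
  bigraph_iso G H -> bigraph_iso H K -> bigraph_iso G K.
Proof.
move=> [f [g [h [fb gb hb fgh]]]] [f' [g' [h' [fb' gb' hb' fgh']]]].
exists (f' \o f), (g' \o g), (h' \o h); split; try exact: bij_comp.
move=> e /=; have [-> -> ->] := fgh' (h e); have [-> -> ->] := fgh e.
by split.
Qed.

Lemma mgraph_iso_refl M : mgraph_iso M M.
Proof. by exists id, id, id; split=> //; exists id. Qed.

Lemma mgraph_iso_trans M N P :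
  mgraph_iso M N -> mgraph_iso N P -> mgraph_iso M P.
Proof.
move=> [f [g [h [fb gb hb fc fgh]]]] [f' [g' [h' [fb' gb' hb' fc' fgh']]]].
exists (f' \o f), (g' \o g), (h' \o h); split; try exact: bij_comp.
  by move=> c u c12 /=; rewrite fc // fc'.
move=> e /=; have [-> -> ->] := fgh' (h e); have [-> -> ->] := fgh e.
by split.
Qed.

Lemma color_cases (c : color) : [\/ c = c0, c = c1, c = c2 | c = c3].
Proof.
by case: c => [[|[|[|[|c]]]] clt] //;
  [constructor 1|constructor 2|constructor 3|constructor 4]; apply: val_inj.
Qed.

Lemma across_id (S : finType) c (u : inner S) :
  c = c0 \/ c = c3 -> across c u = u.
Proof.
by rewrite /across /inner_color; case=> ->; case: (odd _); case: (odd _).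
Qed.

Lemma mopp3 M : @mopp M c3 =1 id.
Proof. by move=> e; rewrite /mopp across_id ?mtipK //; right. Qed.

(** * The colored graph of a stuffed map *)

(* For each color [c], the edge of color [c] at the white vertex [x] of the
   colored graph of [M] ends at the black vertex [mstep M c x]. *)
Definition mstep (M : mgraph) (c : color) : {perm medge M} :=
  if c == c0 then (mrot M)^-1%g else perm (inv_inj (@moppK M c)).

Lemma mstepE M c e : c != c0 -> mstep M c e = mopp c e.
Proof. by move/negPf=> cn0; rewrite /mstep cn0 permE. Qed.

Lemma mstep0 M : mstep M c0 = (mrot M)^-1%g.
Proof. by []. Qed.

Lemma mstep3 M : mstep M c3 = 1%g.
Proof. by apply/permP=> e; rewrite mstepE // mopp3 perm1. Qed.

Lemma mstepV M c : c != c0 -> (mstep M c)^-1%g = mstep M c.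
Proof.
move=> cn0; apply/permP=> e; apply: (@perm_inj _ (mstep M c)).
by rewrite permKV !mstepE // moppK.
Qed.

Definition graph_of (M : mgraph) : bigraph :=
  @BiGraph (medge M) (medge M) (medge M * color)%type
    fst (fun e => mstep M e.2 e.1) snd.

(** Excludes isolated black vertices, which [graph_of] cannot see. Under this condition the black
    vertices are exactly the orbits of [mrot]. *)
Definition foot_onto (M : mgraph) : Prop :=
  forall b : mblack M, exists e : medge M, mfoot e = b.

Lemma foot_onto_iso M N : mgraph_iso M N -> foot_onto M -> foot_onto N.
Proof.
move=> [f [g [h [_ [g' _ g'K] _ _ fgh]]]] ontoM b.
have [e eb] := ontoM (g' b); exists (h e).
by have [_ -> _] := fgh e; rewrite eb g'K.
Qed.

Lemma mopp_iso M N (f : inner (msquare M) -> inner (msquare N))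
    (h : medge M -> medge N) c :
    (forall u, f (across c u) = across c (f u)) ->
    (forall e, mtip (h e) = f (mtip e)) ->
  forall e, h (mopp c e) = mopp c (h e).
Proof.
move=> fc fh e; apply: (can_inj (@mtipK N)).
by rewrite fh /mopp !medge_atK fc fh.
Qed.

Lemma graph_of_iso M N :
  mgraph_iso M N -> bigraph_iso (graph_of M) (graph_of N).
Proof.
move=> [f [g [h [_ _ hb fc fgh]]]].
have hm c : c = c1 \/ c = c2 -> forall e, h (mopp c e) = mopp c (h e).
  move=> c12; apply: (@mopp_iso _ _ f) => [u|e]; first exact: fc.
  by have [] := fgh e.
have hs c e : h (mstep M c e) = mstep N c (h e).
  have [->|->|->|->] := color_cases c.
  - apply: (@perm_inj _ (mrot N)); rewrite !mstep0 permKV.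
    by have [_ _ ->] := fgh ((mrot M)^-1%g e); rewrite permKV.
  - by rewrite !mstepE // hm //; left.
  - by rewrite !mstepE // hm //; right.
  - by rewrite !mstep3 !perm1.
case: (hb) => h' hK h'K.
exists h, h, (fun e => (h e.1, e.2)); split=> // [|e]; last by split=> //=.
by exists (fun e => (h' e.1, e.2)) => -[e c] /=; rewrite ?hK ?h'K.
Qed.

Lemma mfoot_eqP M (e e' : medge M) :
  mfoot e = mfoot e' <-> e \in porbit (mrot M) e'.
Proof. by rewrite mrotP; split => [->|/eqP]. Qed.

Lemma porbit_morph (T U : finType) (f : T -> U) (s : {perm T}) (t : {perm U}) :
    (forall x, f (s x) = t (f x)) ->
  forall x y, y \in porbit s x -> f y \in porbit t (f x).
Proof.
move=> fst x y /porbitP[i ->]; elim: i => [|i IHi];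
  first by rewrite expg0 perm1 porbit_id.
rewrite expgSr permM fst; apply: etrans IHi.
by have := porbit_perm t 1; rewrite expg1 -!eq_porbit_mem => ->.
Qed.

(** Color 3 acts as the identity on both sides, which forces the white and black parts of the
    isomorphism to agree. The common map [h] then commutes with every [mstep]: color 0 gives the
    rotation, colors 1 and 2 the inner edges. *)
Lemma graph_of_iso_inv M N : foot_onto M -> foot_onto N ->
  bigraph_iso (graph_of M) (graph_of N) -> mgraph_iso M N.
Proof.
move=> ontoM ontoN [h [g [k [hb _ _ hgk]]]].
have gs c e : g (mstep M c e) = mstep N c (h e).
  by have [w b c'] := hgk (e, c); rewrite /= in w b c'; rewrite -b w c'.
have gh e : g e = h e by have := gs c3 e; rewrite !mstep3 !perm1.
have hs c e : h (mstep M c e) = mstep N c (h e) by rewrite -gh gs.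
have hrot e : mrot N (h e) = h (mrot M e).
  by rewrite -{1}(permK (mrot M) e) -mstep0 hs mstep0 permKV.
have [h' hK h'K] := hb.
have h'rot e : mrot M (h' e) = h' (mrot N e).
  by rewrite -{2}(h'K e) hrot hK.
have feet e e' : mfoot (h e) = mfoot (h e') <-> mfoot e = mfoot e'.
  rewrite !mfoot_eqP; split; last exact: porbit_morph.
  by rewrite -{2}(hK e) -{2}(hK e'); apply: porbit_morph.
(* [a] picks an edge at each black vertex [b], which is sent to the foot of [h (a b)]; by [feet] the
   choice is immaterial. *)
have /choice[a aP] := ontoM.
have ga e : mfoot (h (a (mfoot e))) = mfoot (h e) by rewrite feet.
exists (fun u => mtip (h (medge_at u))), (fun b => mfoot (h (a b))), h; split.
- exists (fun u => mtip (h' (medge_at u))) => u;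
    by rewrite ?mtipK ?hK ?h'K medge_atK.
- apply: inj_surj_bij => [b b'|b]; first by rewrite feet !aP.
  by have [e <-] := ontoN b; exists (mfoot (h' e)); rewrite ga h'K.
- exact: hb.
- move=> c u c12.
  have cn0 : c != c0 by case: c12 => ->.
  rewrite -{1}(medge_atK u) -[medge_at _]/(mopp c (medge_at u)).
  by rewrite -mstepE // hs mstepE // medge_atK.
- by move=> e; rewrite mtipK ga.
Qed.

(** * Squares, the octahedral graph and adjacency *)

Lemma across_fst (S : finType) c (u : inner S) : (across c u).1 = u.1.
Proof. by rewrite /across; case: ifP => // _; case: ifP. Qed.

Lemma across_inner_color (S : finType) (s : S) j :
  across (inner_color j) (s, j) = (s, ordS j).
Proof. by rewrite /across eqxx. Qed.

(** With the white vertices of B placed cyclically on a square and each black vertex identified with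
    its neighbor of color 3, the edges of colors 1 and 2 are the sides of the square. The index
    [c.-1] undoes the shift between rows and colors. *)
Lemma octahedron_across (S : finType) c (u : inner S) : c != c0 ->
  @bend octahedron (inord c.-1, u.2) = (across c u).2.
Proof.
case: u => s [j jlt]; have [->|->|->|->] // := color_cases c => _;
  apply: val_inj; rewrite /= inordK;
  by move: jlt; case: j => [|[|[|[|j]]]] //= jlt; rewrite inordK.
Qed.

Lemma octahedron_color (c : color) j :
  c != c0 -> @gcolor octahedron (inord c.-1, j) = c.
Proof.
by have [->|->|->|->] // := color_cases c => _; apply: val_inj;
  rewrite /= inordK.
Qed.

Lemma mtip_mopp M c (x : medge M) : mtip (mopp c x) = across c (mtip x).
Proof. by rewrite /mopp medge_atK. Qed.

Lemma mopp_at M c u : mopp c (@medge_at M u) = medge_at (across c u).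
Proof. by rewrite /mopp medge_atK. Qed.

Lemma adj_sym G (P : {pred color}) : symmetric (@adj G P).
Proof. by move=> u v; apply: eq_existsb => e; rewrite orbC. Qed.

Lemma adj_edge G (P : {pred color}) (e : gedge G) :
  gcolor e \in P -> adj P (inl (wend e)) (inr (bend e)).
Proof. by move=> eP; apply/existsP; exists e; rewrite eP !eqxx. Qed.

Lemma adjP G (P : {pred color}) (r : rel (vertex G)) :
    symmetric r ->
    (forall e : gedge G, gcolor e \in P -> r (inl (wend e)) (inr (bend e))) ->
  forall u v, adj P u v -> r u v.
Proof.
move=> r_sym rP u v /existsP[e /andP[eP]].
by case/orP=> /andP[/eqP-> /eqP->]; [|rewrite r_sym]; apply: rP.
Qed.

Lemma adj_connect_sym G (P : {pred color}) : connect_sym (@adj G P).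
Proof. exact/sym_connect_sym/adj_sym. Qed.

Lemma madj_sym M : symmetric (@madj M).
Proof.
case=> [u|b] [v|b'] //=; congr (_ || _);
  by apply/eqP/eqP => ->; rewrite acrossK.
Qed.

Lemma madj_connect_sym M : connect_sym (@madj M).
Proof. exact/sym_connect_sym/madj_sym. Qed.

Lemma madj_foot M (e : medge M) : madj (inl (mtip e)) (inr (mfoot e)).
Proof. by apply/existsP; exists e; rewrite !eqxx. Qed.

(** A path from a black vertex to some square must begin with an edge at that black vertex. *)
Lemma stuffed_map_onto M : stuffed_map M -> foot_onto M.
Proof.
move=> [[_ con] /card_gt0P[s _]] b.
have /connectP[[|[u|b'] p] //=] := con (inr b) (inl (s, ord0)).
by case/andP=> /existsP[e /andP[_ /eqP eb]] _ _; exists e.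
Qed.

Lemma set_bij_card (T U : finType) (A : {pred T}) (B : {pred U}) (f : T -> U) :
  set_bij [set` A]%classic [set` B]%classic f -> #|A| = #|B|.
Proof.
move=> [fAB f_inj f_onto].
have f_injA : {in A &, injective f}.
  by move=> x y xA yA; apply: f_inj; rewrite mem_setE.
rewrite -(card_in_image f_injA); apply: eq_card => y.
apply/fintype.imageP/idP => [[x xA ->]|yB]; first exact: fAB.
by have [x xA <-] := f_onto y yB; exists x.
Qed.

(** * Bubbles and faces of the colored graph of a stuffed map *)

(* As [mstep M c3 = 1], [bpos] is [wpos] across the edge of color 3. *)
Record unfolded (G : bigraph) (M : mgraph) := Unfolded {
  wpos : white G -> medge M;
  wat : medge M -> white G;
  wposK : cancel wpos wat;
  watK : cancel wat wpos;
  bpos : black G -> medge M;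
  bat : medge M -> black G;
  bposK : cancel bpos bat;
  batK : cancel bat bpos;
  edge_at : medge M -> color -> gedge G;
  wend_edge_at : forall x c, wend (edge_at x c) = wat x;
  bend_edge_at : forall x c, bend (edge_at x c) = bat (mstep M c x);
  gcolor_edge_at : forall x c, gcolor (edge_at x c) = c;
  edge_atK : forall e, edge_at (wpos (wend e)) (gcolor e) = e
}.

(** The edge of color [c] at position [x] is the preimage of the pair [(x, c)]. *)
Lemma unfolded_iso G M : bigraph_iso G (graph_of M) -> inhabited (unfolded G M).
Proof.
move=> [f [g [h [[f' fK f'K] [g' gK g'K] [h' hK h'K] fgh]]]].
have hE e : h e = (f (wend e), gcolor e).
  by have [/= <- _ <-] := fgh e; case: (h e).
have h'E x c : [/\ wend (h' (x, c)) = f' x, bend (h' (x, c)) = g' (mstep M c x)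
                 & gcolor (h' (x, c)) = c].
  have [/= w b c'] := fgh (h' (x, c)); rewrite h'K /= in w b c'.
  by split=> //; [rewrite [X in f' X]w fK | rewrite [X in g' X]b gK].
constructor.
apply: (@Unfolded _ _ f f' fK f'K g g' gK g'K (fun x c => h' (x, c)))
  => [x c|x c|x c|e].
- by have [] := h'E x c.
- by have [] := h'E x c.
- by have [] := h'E x c.
- by rewrite -hE hK.
Qed.

Lemma unfolded_graph_of M : inhabited (unfolded (graph_of M) M).
Proof. exact: unfolded_iso (bigraph_iso_refl _). Qed.

Section Unfolded.
Variables (G : bigraph) (M : mgraph) (U : unfolded G M).
Implicit Types (e : gedge G) (x y : medge M) (c a : color).

Definition epos e : medge M := wpos U (wend e).

Lemma epos_edge_at x c : epos (edge_at U x c) = x.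
Proof. by rewrite /epos wend_edge_at watK. Qed.

Lemma edge_at_epos e c : gcolor e = c -> edge_at U (epos e) c = e.
Proof. by move<-; apply: edge_atK. Qed.

Lemma bpos_bend e : bpos U (bend e) = mstep M (gcolor e) (epos e).
Proof. by rewrite -[in LHS](edge_atK U e) bend_edge_at batK. Qed.

Lemma bend_eqP e f : bend e = bend f <->
  mstep M (gcolor e) (epos e) = mstep M (gcolor f) (epos f).
Proof.
rewrite -!bpos_bend; split=> [-> // | ].
exact: (can_inj (bposK U)).
Qed.

Lemma epos_inj e f : gcolor e = gcolor f -> epos e = epos f -> e = f.
Proof. by move=> cef ef; rewrite -(edge_at_epos cef) ef edge_at_epos. Qed.

Lemma wend_eqP e f : wend e = wend f <-> epos e = epos f.
Proof. by split=> [ef|/(can_inj (wposK U))//]; rewrite /epos ef. Qed.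

(** * Faces as orbits of a permutation of the edges of M *)

Section Faces.
Variable a : color.
Hypothesis an0 : a != c0.

(** Leads from one white vertex of a face of color [a] to the next: out along color 0, back along
    color [a]. *)
Definition fstep : {perm medge M} := (mstep M c0 * (mstep M a)^-1)%g.

Definition onface e : bool := (gcolor e == c0) || (gcolor e == a).

(** The successor for [alternate a], extended by the identity to the other colors so as to be a
    permutation of all edges. *)
Definition fnext e : gedge G :=
  if gcolor e == c0 then edge_at U (fstep (epos e)) a
  else if gcolor e == a then edge_at U (epos e) c0 else e.

Lemma alternateE e f : alternate a e f = onface e && (fnext e == f).
Proof.
have a0 : (a == c0) = false by apply/negbTE.
rewrite /alternate /onface /fnext.
have [ce0|ce0] := eqVneq (gcolor e) c0 => /=.
  rewrite ce0 [c0 == a]eq_sym a0 /= orbF; apply/andP/eqP => [[/eqP cf /eqP]|<-].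
    rewrite bend_eqP ce0 cf => ef.
    by rewrite /fstep permM ef permK edge_at_epos.
  rewrite gcolor_edge_at eqxx; split=> //; apply/eqP/bend_eqP.
  by rewrite gcolor_edge_at epos_edge_at ce0 /fstep permM permKV.
have [cea|] := eqVneq (gcolor e) a => //=.
apply/andP/eqP => [[/eqP cf /eqP/wend_eqP ->]|<-];
  first by rewrite edge_at_epos.
rewrite gcolor_edge_at eqxx; split=> //; apply/eqP/wend_eqP.
by rewrite epos_edge_at.
Qed.

Lemma fnext_inj : injective fnext.
Proof.
have a0 : (a == c0) = false by apply/negbTE.
(* The inverse of [fnext], which walks along the faces backwards. *)
pose p e := if gcolor e == a then edge_at U (fstep^-1%g (epos e)) c0
            else if gcolor e == c0 then edge_at U (epos e) a else e.
apply: (@can_inj _ _ _ p) => e; rewrite /p /fnext.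
have [ce0|ce0] := eqVneq (gcolor e) c0.
  by rewrite gcolor_edge_at eqxx epos_edge_at permK edge_at_epos.
have [cea|cea] := eqVneq (gcolor e) a.
  by rewrite gcolor_edge_at eqxx eq_sym a0 epos_edge_at edge_at_epos.
by rewrite (negPf ce0) (negPf cea).
Qed.

(** The face through the white vertex at position [x], described by the positions of the white ends
    of its edges. *)
Definition facet x : {set gedge G} :=
  [set e | onface e && (epos e \in porbit fstep x)].

Lemma onface_next e : onface e -> onface (fnext e).
Proof.
rewrite /onface /fnext; case: ifP => _ /=;
  first by rewrite gcolor_edge_at eqxx orbT.
by move=> cea; rewrite cea gcolor_edge_at eqxx.
Qed.

Lemma epos_next e : epos (fnext e) \in porbit fstep (epos e).
Proof.
rewrite /fnext; case: ifP => _; last case: ifP => _;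
  rewrite ?epos_edge_at ?porbit_id //.
by rewrite -{1}[fstep]expg1 mem_porbit.
Qed.

Lemma fconnect_edge0 e : onface e -> fconnect fnext e (edge_at U (epos e) c0).
Proof.
case/orP=> [/eqP/edge_at_epos->//|/eqP cea].
by apply: connect1; rewrite /= /fnext cea (negPf an0) eqxx.
Qed.

(** Between edges of color 0, two steps of [fnext] make one step of [fstep]. *)
Lemma fconnect_fstep x i :
  fconnect fnext (edge_at U x c0) (edge_at U ((fstep ^+ i)%g x) c0).
Proof.
elim: i => [|i IHi]; first by rewrite expg0 perm1.
apply: connect_trans IHi _; rewrite expgSr permM.
set y := (fstep ^+ i)%g x.
apply: connect_trans (fconnect1 _ _) _.
have -> : fnext (edge_at U y c0) = edge_at U (fstep y) a.
  by rewrite /fnext gcolor_edge_at eqxx epos_edge_at.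
rewrite -{2}(epos_edge_at (fstep y) a); apply: fconnect_edge0.
by rewrite /onface gcolor_edge_at eqxx orbT.
Qed.

Lemma orbit_facet e : onface e -> [set:: orbit fnext e] = facet (epos e).
Proof.
move=> one; apply/setP=> f; rewrite !inE -fconnect_orbit.
apply/idP/andP=> [/iter_findex <-|[onf /porbitP[i ef]]].
  elim: (findex _ _ _) => [|n [onn en]] /=; first by rewrite porbit_id.
  split; first exact: onface_next.
  rewrite -eq_porbit_mem; rewrite -eq_porbit_mem in en; rewrite -(eqP en).
  by rewrite eq_porbit_mem epos_next.
(* The walk passes through the edges of color 0 at the white ends of [e] and [f]; its last leg is
   reversed by injectivity of [fnext]. *)
apply: connect_trans (fconnect_edge0 one) _.
apply: connect_trans (fconnect_fstep _ i) _; rewrite -ef.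
by rewrite (fconnect_sym fnext_inj) fconnect_edge0.
Qed.

(** On edges of colors 0 and [a], [alternate a] is the graph of the injection [fnext], so its cycles
    without repetition are the orbits of [fnext]. *)
Lemma facesP C : C \in faces G a <-> exists x, C = facet x.
Proof.
rewrite inE; split=> [/asboolP[s [s0 /andP[cs us] ->]]|[x ->]].
  case: s s0 cs us => // e s _ cs us; exists (epos e).
  have onC f : f \in e :: s -> onface f.
    (* Every edge of the cycle has a successor in it, hence is of color 0 or [a]. *)
    by move=> fs; have := next_cycle cs fs; rewrite alternateE; case/andP.
  have fc : fcycle fnext (e :: s).
    by apply: sub_cycle cs => u v; rewrite alternateE => /andP[].
  have es : e \in e :: s by rewrite mem_head.
  rewrite -orbit_facet ?onC //; apply/setP=> f.
  by rewrite !finset.in_set -fconnect_orbit (fconnect_cycle fc es).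
have onx : onface (edge_at U x c0) by rewrite /onface gcolor_edge_at.
apply/asboolP; exists (orbit fnext (edge_at U x c0)).
split; last by rewrite orbit_facet // epos_edge_at.
  by rewrite -size_eq0 size_orbit -lt0n fingraph.order_gt0.
apply/andP; split; last exact: orbit_uniq.
apply: (sub_in_cycle (P := onface)) (cycle_orbit fnext_inj _) => [e f one _|].
  by move=> ef; rewrite alternateE; apply/andP.
have /setP orbE := orbit_facet onx.
by apply/allP=> e eo; have := orbE e; rewrite !inE eo => /esym/andP[].
Qed.

Lemma epos_facet x : epos @: facet x = porbit fstep x.
Proof.
apply/setP=> y; apply/imsetP/idP=> [[e] | xy];
  first by rewrite inE => /andP[_ ?] ->.
by exists (edge_at U y c0); rewrite ?inE /onface ?gcolor_edge_at ?epos_edge_at.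
Qed.

(** A face contains both the edge of color 0 and that of color [a] at each of its white vertices, so
    its positions determine it. *)
Lemma facet_epos C : C \in faces G a ->
  C = [set e | onface e && (epos e \in epos @: C)].
Proof. by case/facesP=> x ->; rewrite epos_facet. Qed.

Lemma epos_faces C : C \in faces G a -> epos @: C \in porbits fstep.
Proof. by case/facesP=> x ->; rewrite epos_facet imset_f. Qed.

Lemma epos_faces_inj :
  {in faces G a &, injective (fun C : {set gedge G} => epos @: C)}.
Proof. by move=> C D /facet_epos CE /facet_epos DE CD; rewrite CE DE CD. Qed.

Lemma epos_faces_onto O :
  O \in porbits fstep -> exists2 C, C \in faces G a & epos @: C = O.
Proof.
case/imsetP=> x _ ->; exists (facet x); last exact: epos_facet.
by apply/facesP; exists x.
Qed.

End Faces.

(** Since [mopp c] is an involution, [fstep c] is the inverse of [face_perm], and inverse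
    permutations have the same orbits. *)
Lemma porbits_fstep c :
  c != c0 -> porbits (fstep c) = porbits (face_perm (mmap M c)).
Proof.
move=> cn0; rewrite -[RHS]porbitsV; congr porbits.
rewrite /fstep mstepV // mstep0 /face_perm invMg; congr (_ * _)%g.
by rewrite -mstepV // /mstep (negPf cn0).
Qed.

Hypothesis onto : foot_onto M.

Lemma faces_map_faces c : c != c0 -> faces_to_map_faces (wpos U) c.
Proof.
move=> cn0.
exists (fun C : {set gedge G} => inl (epos @: C) : pre_face (mmap M c)).
split; last first.
  by move=> C e CF eC; apply: imset_f.
split.
- by move=> C /= CF; rewrite inE -porbits_fstep // epos_faces.
- by move=> C D /set_mem /= CF /set_mem /= DF [] CD;
    apply: (epos_faces_inj cn0).
- case=> [O|b] /=; rewrite inE.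
    rewrite -porbits_fstep // => /(epos_faces_onto cn0)[C CF <-].
    by exists C.
  (* By [onto], no face of the map comes from an isolated vertex. *)
  by have [e eb] := onto b; move/existsP; case; exists e; apply/eqP.
Qed.

Hypothesis x0 : medge M.

(** As color 3 acts trivially, [fstep c3] is the inverse rotation, whose orbits are the sets of
    edges around the black vertices. *)
Lemma faces_black_vertices : faces_to_black_vertices (wpos U).
Proof.
have f3 : fstep c3 = (mrot M)^-1%g by rewrite /fstep mstep3 mstep0 invg1 mulg1.
have c30 : c3 != c0 by [].
have /choice[psi psiP] (C : {set gedge G}) : exists b : mblack M,
    forall e, C \in faces G c3 -> e \in C -> b = mfoot (epos e).
  have [/(facesP c30)[x ->]|nF] := boolP (C \in faces G c3);
    (* An arbitrary value for sets that are not faces. *)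
    last by exists (mfoot x0).
  exists (mfoot x) => e _; rewrite inE f3 porbitV => /andP[_ ex].
  by symmetry; apply/mfoot_eqP.
have psiE x : psi (facet c3 x) = mfoot x.
  rewrite (psiP _ (edge_at U x c0)) ?epos_edge_at //;
    first by apply/(facesP c30); exists x.
  by rewrite inE /onface gcolor_edge_at epos_edge_at porbit_id.
exists psi; split; last exact: psiP.
split=> // [C D|b _].
  case/set_mem/(facesP c30)=> x -> /set_mem /= /(facesP c30)[y ->].
  rewrite !psiE mfoot_eqP => xy; apply/setP=> e.
  rewrite -eq_porbit_mem in xy.
  by rewrite !inE f3 !porbitV (eqP xy).
have [x <-] := onto b; exists (facet c3 x) => //=.
by apply/(facesP c30); exists x.
Qed.


(** * Bubbles as squares *)

Definition vpos (v : vertex G) : medge M :=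
  match v with inl x => wpos U x | inr y => bpos U y end.

Definition vat x : vertex G := inl (wat U x).

Lemma vpos_at x : vpos (vat x) = x.
Proof. exact: watK. Qed.

Lemma adj_edge_at (P : {pred color}) x c :
  c \in P -> adj P (vat x) (inr (bat U (mstep M c x))).
Proof.
move=> cP; rewrite /vat -(wend_edge_at U x c) -bend_edge_at.
by apply: adj_edge; rewrite gcolor_edge_at.
Qed.

(** The edge of color 3 joins a black vertex to the white vertex at the same position, so
    reachability need only be studied between white vertices. *)
Lemma connect_at (P : {pred color}) v :
  c3 \in P -> connect (adj P) v (vat (vpos v)).
Proof.
move=> P3; case: v => [x|y] /=; first by rewrite /vat wposK.
rewrite adj_connect_sym; apply: connect1.
by have := adj_edge_at (bpos U y) P3; rewrite mstep3 perm1 bposK.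
Qed.

Lemma connect_mstep (P : {pred color}) x c : c \in P -> c3 \in P ->
  connect (adj P) (vat x) (vat (mstep M c x)).
Proof.
move=> cP P3; apply: connect_trans (connect1 (adj_edge_at x cP)) _.
by have := connect_at (inr (bat U (mstep M c x))) P3; rewrite /= batK.
Qed.

Definition vsquare (v : vertex G) : msquare M := (mtip (vpos v)).1.

Local Notation badj := (@adj G [pred c | c != c0]).

Lemma connect_square s (i j : 'I_4) :
  connect badj (vat (medge_at (s, i))) (vat (medge_at (s, j))).
Proof.
have con k : connect badj (vat (medge_at (s, k))) (vat (medge_at (s, ordS k))).
  have cn0 : inner_color k != c0 by rewrite /inner_color; case: ifP.
  by rewrite -across_inner_color -mopp_at -mstepE //; apply: connect_mstep.
(* Going round from corner 0 never needs the wrap-around of [ordS]. *)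
have con0 k : connect badj (vat (medge_at (s, ord0))) (vat (medge_at (s, k))).
  case: k => k; elim: k => [|k IHk] klt.
    by rewrite (_ : Ordinal klt = ord0) //; apply: val_inj.
  apply: connect_trans (IHk (ltnW klt)) _.
  rewrite (_ : Ordinal klt = ordS (Ordinal (ltnW klt))) //.
  by apply: val_inj; rewrite /= modn_small.
by apply: connect_trans (con0 j); rewrite adj_connect_sym.
Qed.

(** Crossing an edge of color 1, 2 or 3 stays on the same square, and the sides of a square connect
    its four corners. *)
Lemma connect_bubble u v : connect badj u v = (vsquare u == vsquare v).
Proof.
apply/idP/eqP => [uv | suv].
  suff: connect eq_op (vsquare u) (vsquare v).
    case/connectP=> p; elim: p (vsquare u) => [x _ -> //|y p IHp x].
    by case/andP=> /eqP-> /IHp.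
  apply: connect_homo uv => {}u {}v; move: u v; apply: adjP => [u v|e /=];
    last first.
    by rewrite inE => en0; rewrite /vsquare /= bpos_bend mstepE //
      mtip_mopp across_fst connect0.
  by apply: sym_connect_sym => x y; apply: eq_sym.
apply: connect_trans (connect_at u _) _ => //.
rewrite adj_connect_sym; apply: connect_trans (connect_at v _) _ => //.
rewrite -[vpos u]mtipK -[vpos v]mtipK.
move: suv; rewrite /vsquare; case: (mtip _) => s i; case: (mtip _) => t j /= ->.
exact: connect_square.
Qed.

Definition bubble (s : msquare M) : {set vertex G} := [set v | vsquare v == s].

Lemma vsquare_at s j : vsquare (vat (medge_at (s, j))) = s.
Proof. by rewrite /vsquare vpos_at medge_atK. Qed.

Lemma bubblesP S : S \in bubbles G <-> exists s, S = bubble s.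
Proof.
split=> [/imsetP[u _ ->]|[s ->]].
  by exists (vsquare u); apply/setP=> v; rewrite !inE /= connect_bubble eq_sym.
apply/imsetP; exists (vat (medge_at (s, ord0))) => //.
by apply/setP=> v; rewrite !inE connect_bubble vsquare_at eq_sym.
Qed.

Lemma bubbles_squares : bubbles_to_squares (wpos U).
Proof.
(* The square is read off any vertex of the bubble; the empty set gets an arbitrary one. *)
pose beta (S : {set vertex G}) :=
  if [pick v in S] is Some v then vsquare v else (mtip x0).1.
have betaE s : beta (bubble s) = s.
  rewrite /beta; case: pickP => [v|/(_ (vat (medge_at (s, ord0))))].
    by rewrite inE => /eqP.
  by rewrite inE vsquare_at eqxx.
exists beta; split; last first.
  by move=> S x /bubblesP[s ->]; rewrite betaE inE => /eqP.
split=> //.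
  by move=> S S' /set_mem /bubblesP[s ->] /set_mem /bubblesP[s' ->];
    rewrite !betaE => ->.
by move=> s _; exists (bubble s); rewrite ?betaE //; apply/bubblesP; exists s.
Qed.

Lemma card_bubbles : #|bubbles G| = #|msquare M|.
Proof.
have [beta [bij _]] := bubbles_squares.
apply: (@set_bij_card _ _ _ predT beta);
  rewrite (_ : [set` predT] = setT)%classic //.
by apply/seteqP; split.
Qed.

Lemma nfaces_mnfaces : nfaces G = mnfaces M.
Proof.
have [phi1 [bij1 _]] := faces_map_faces (isT : c1 != c0).
have [phi2 [bij2 _]] := faces_map_faces (isT : c2 != c0).
have [psi [bij3 _]] := faces_black_vertices.
rewrite /nfaces (set_bij_card bij1) (set_bij_card bij2); congr (_ + _).
apply: (@set_bij_card _ _ _ predT psi);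
  rewrite (_ : [set` predT] = setT)%classic //.
by apply/seteqP; split.
Qed.

(** * Transfer of connectedness *)

Lemma connected_stuffed : connected_graph (@adj G predT) -> stuffed_map M.
Proof.
move=> [_ con]; split; last by apply/card_gt0P; exists (mtip x0).1.
(* Under [f], edges of colors 1 and 2 become inner edges, those of color 3 collapse, and those of
   color 0 become paths through a black vertex. *)
pose f v : mvertex M := inl (mtip (vpos v)).
have conf u v : connect (@madj M) (f u) (f v).
  apply: connect_homo (con u v) => {}u {}v; move: u v; apply: adjP => [u v|e _].
    exact: madj_connect_sym.
  rewrite /f /= bpos_bend; have [ce|ce] := eqVneq (gcolor e) c0.
    rewrite ce mstep0; set x := epos e.
    have -> : wpos U (wend e) = x by [].
    apply: connect_trans (connect1 (madj_foot x)) _.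
    rewrite madj_connect_sym (_ : mfoot x = mfoot ((mrot M)^-1%g x));
      first exact/connect1/madj_foot.
    by apply/mfoot_eqP; rewrite -{1}(permKV (mrot M) x) -{1}[mrot M]expg1
      mem_porbit.
  rewrite mstepE // mtip_mopp -[wpos U _]/(epos e).
  have [ec|ec|ec|ec] := color_cases (gcolor e); rewrite ec ?eqxx // in ce *.
  - by apply: connect1; rewrite /= eqxx.
  - by apply: connect1; rewrite /= eqxx orbT.
  - by rewrite -mtip_mopp mopp3.
have cona w : exists v, connect (@madj M) w (f v).
  case: w => [u|b].
    by exists (vat (medge_at u)); rewrite /f vpos_at medge_atK.
  have [x <-] := onto b; exists (vat x); rewrite /f vpos_at madj_connect_sym.
  exact/connect1/madj_foot.
split; first by apply/card_gt0P; exists (inr (mfoot x0)).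
move=> w w'; have [v wv] := cona w; have [v' wv'] := cona w'.
apply: connect_trans wv _; rewrite madj_connect_sym.
by apply: connect_trans wv' _.
Qed.

Lemma stuffed_connected : stuffed_map M -> connected_graph (@adj G predT).
Proof.
move=> [[_ con] _]; split; first by apply/card_gt0P; exists (vat x0).
have /choice[r rP] := onto.
(* A black vertex is represented by the chosen edge [r b]; the other edges at [b] are reached by
   rotating, that is along colors 0 and 3. *)
pose f (w : mvertex M) :=
  match w with inl u => vat (medge_at u) | inr b => vat (r b) end.
pose cadj := connect (@adj G predT).
have cadj_sym : connect_sym (@adj G predT) := @adj_connect_sym G predT.
have rot i x : cadj (vat x) (vat ((mrot M ^+ i)%g x)).
  elim: i => [|i IHi]; first by rewrite expg0 perm1 /cadj.
  apply: connect_trans IHi _; rewrite expgSr permM; set y := (mrot M ^+ i)%g x.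
  rewrite cadj_sym -{2}(permK (mrot M) y) -mstep0.
  exact: connect_mstep.
have foot x : cadj (vat x) (vat (r (mfoot x))).
  have /mfoot_eqP/porbitP[i ->] := rP (mfoot x); exact: rot.
have acr c u : cadj (vat (medge_at u)) (vat (medge_at (across c u))).
  have [->|cn0] := eqVneq c c0.
    by rewrite across_id ?/cadj //; left.
  by rewrite -mopp_at -mstepE //; apply: connect_mstep.
have conf w w' : cadj (f w) (f w').
  apply: connect_homo (con w w') => {w w'}.
  case=> [u|b] [v|b'] //= .
  - by case/orP=> /eqP->; apply: acr.
  - by case/existsP=> x /andP[/eqP<- /eqP<-]; rewrite mtipK; apply: foot.
  - case/existsP=> x /andP[/eqP<- /eqP<-]; rewrite mtipK cadj_sym; apply: foot.
move=> u v; apply: connect_trans (connect_at u _) _ => //.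
rewrite cadj_sym; apply: connect_trans (connect_at v _) _ => //.
by have := conf (inl (mtip (vpos v))) (inl (mtip (vpos u))); rewrite /= !mtipK.
Qed.

(** Each vertex is sent to the index of its corner on the square [s]; [octahedron_across] then
    matches the black ends. *)
Lemma bubble_octahedron s : bigraph_iso (bubble_graph (bubble s)) octahedron.
Proof.
pose f (x : white (bubble_graph (bubble s))) := (mtip (wpos U (val x))).2.
pose g (y : black (bubble_graph (bubble s))) := (mtip (bpos U (val y))).2.
pose h (e : gedge (bubble_graph (bubble s))) : gedge octahedron :=
  (inord (gcolor (val e)).-1, f (wend e)).
have tip_inj x y : (mtip x).1 = s -> (mtip y).1 = s ->
  (mtip x).2 = (mtip y).2 -> x = y.
  move=> xs ys xy; apply: (can_inj (@mtipK M)).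
  by rewrite [mtip x]surjective_pairing [mtip y]surjective_pairing xs ys xy.
have f_inj : injective f.
  move=> [x xs] [y ys]; rewrite /f /= => xy; apply: val_inj => /=.
  rewrite !inE in xs ys; apply: (can_inj (wposK U)).
  by apply: tip_inj xy; [exact: (eqP xs)|exact: (eqP ys)].
exists f, g, h; split.
- apply: inj_surj_bij => // j.
  have js : inl (wat U (medge_at (s, j))) \in bubble s.
    by rewrite inE -[inl _]/(vat _) vsquare_at.
  by exists (exist (fun x : white G => inl x \in bubble s) _ js);
    rewrite /f /= watK medge_atK.
- apply: inj_surj_bij => [[x xs] [y ys]|j].
    rewrite /g /= => xy; apply: val_inj => /=.
    rewrite !inE in xs ys; apply: (can_inj (bposK U)).
    by apply: tip_inj xy; [exact: (eqP xs)|exact: (eqP ys)].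
  have js : inr (bat U (medge_at (s, j))) \in bubble s.
    by rewrite inE /vsquare /= batK medge_atK.
  by exists (exist (fun y : black G => inr y \in bubble s) _ js);
    rewrite /g /= batK medge_atK.
- apply: inj_surj_bij => [d e de|[k j]].
    have /= cd : gcolor (val d) = gcolor (val e).
      have dn0 : gcolor (val d) != c0 by case: (d) => ? /= /and3P[].
      have en0 : gcolor (val e) != c0 by case: (e) => ? /= /and3P[].
      rewrite -(octahedron_color (f (wend d)) dn0).
      rewrite -(octahedron_color (f (wend e)) en0).
      exact: (congr1 (@gcolor octahedron) de).
    apply/val_inj/epos_inj => //; apply/wend_eqP.
    by have /f_inj/(congr1 val) := congr1 snd de.
  pose e := edge_at U (medge_at (s, j)) (lift ord0 k).
  have es : bubble_edge (bubble s) e.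
    rewrite /bubble_edge gcolor_edge_at /= wend_edge_at bend_edge_at !inE.
    by rewrite -[inl _]/(vat _) vsquare_at /vsquare /= batK mstepE //
      mtip_mopp across_fst medge_atK eqxx.
  exists (exist (bubble_edge (bubble s)) e es);
    rewrite /h /f /= gcolor_edge_at wend_edge_at watK medge_atK /=.
  by rewrite add0n inord_val.
- move=> e; have en0 : gcolor (val e) != c0 by case: (e) => ? /= /and3P[].
  split=> //; last exact: octahedron_color.
  rewrite /h /g /f /= bpos_bend mstepE // mtip_mopp.
  exact: octahedron_across.
Qed.

End Unfolded.

(** * The stuffed map of an octahedral graph *)

Lemma colored_edges G : colored_graph G ->
  exists (we : white G -> color -> gedge G) (be : black G -> color -> gedge G),
    [/\ forall x c, wend (we x c) = x /\ gcolor (we x c) = c,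
        forall y c, bend (be y c) = y /\ gcolor (be y c) = c,
        forall e, we (wend e) (gcolor e) = e
      & forall e, be (bend e) (gcolor e) = e].
Proof.
move=> [wG bG].
have /choice[we weP] (p : white G * color) : exists e : gedge G,
    [set e | (wend e == p.1) && (gcolor e == p.2)] = [set e].
  by apply/cards1P/eqP/wG.
have /choice[be beP] (p : black G * color) : exists e : gedge G,
    [set e | (bend e == p.1) && (gcolor e == p.2)] = [set e].
  by apply/cards1P/eqP/bG.
exists (fun x c => we (x, c)), (fun y c => be (y, c)); split.
- by move=> x c; have /setP/(_ (we (x, c))) := weP (x, c);
    rewrite !inE eqxx => /andP[/eqP ? /eqP].
- by move=> y c; have /setP/(_ (be (y, c))) := beP (y, c);
    rewrite !inE eqxx => /andP[/eqP ? /eqP].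
- by move=> e; have /setP/(_ e) := weP (wend e, gcolor e);
    rewrite !inE !eqxx => /esym/eqP.
- by move=> e; have /setP/(_ e) := beP (bend e, gcolor e);
    rewrite !inE !eqxx => /esym/eqP.
Qed.

Lemma graph_of_colored M : colored_graph (graph_of M).
Proof.
split=> [x c|y c] /=.
  by apply/eqP/cards1P; exists (x, c); apply/setP=> -[x' c']; rewrite !inE.
apply/eqP/cards1P; exists ((mstep M c)^-1%g y, c); apply/setP=> -[x c'].
rewrite !inE /= xpair_eqE; have [->|] := eqVneq c' c; rewrite ?andbF // !andbT.
by apply/eqP/eqP=> [<-|->]; rewrite ?permK ?permKV.
Qed.

Lemma bubble_connect G (S : {set vertex G}) : S \in bubbles G ->
  exists u, S = [set v | connect (adj [pred c | c != c0]) u v].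
Proof.
by case/imsetP=> u _ ->; exists u; apply/setP=> v; rewrite !inE.
Qed.

Lemma bubble_ends G (S : {set vertex G}) (e : gedge G) :
    S \in bubbles G -> gcolor e != c0 ->
  (inl (wend e) \in S) = (inr (bend e) \in S).
Proof.
case/bubble_connect=> u -> en0; rewrite !inE.
apply: same_connect_r; first exact: adj_connect_sym.
exact/connect1/adj_edge.
Qed.

Section Folding.
Variables (G : bigraph) (we : white G -> color -> gedge G)
  (be : black G -> color -> gedge G).
Hypothesis weP : forall x c, wend (we x c) = x /\ gcolor (we x c) = c.
Hypothesis beP : forall y c, bend (be y c) = y /\ gcolor (be y c) = c.
Hypothesis weK : forall e, we (wend e) (gcolor e) = e.
Hypothesis beK : forall e, be (bend e) (gcolor e) = e.

(** Returning along color 3 turns color [c] into a permutation of the white vertices; [wback c]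
    follows the same route in reverse. *)
Definition wstep c x := wend (be (bend (we x c)) c3).
Definition wback c x := wend (be (bend (we x c3)) c).

Lemma we_wend e c : gcolor e = c -> we (wend e) c = e.
Proof. by move<-; apply: weK. Qed.

Lemma be_bend e c : gcolor e = c -> be (bend e) c = e.
Proof. by move<-; apply: beK. Qed.

Lemma wstepK c : cancel (wstep c) (wback c).
Proof.
move=> x; have [wx cx] := weP x c; rewrite /wback /wstep we_wend.
  by rewrite (beP _ _).1 be_bend.
exact: (beP _ _).2.
Qed.

Lemma wbackK c : cancel (wback c) (wstep c).
Proof.
move=> x; have [wx cx] := weP x c3; rewrite /wback /wstep we_wend.
  by rewrite (beP _ _).1 be_bend.
exact: (beP _ _).2.
Qed.

Lemma wstep_bubble S x c : S \in bubbles G -> c != c0 ->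
  (inl (wstep c x) \in S) = (inl x \in S).
Proof.
move=> SG cn0; have [wx cx] := weP x c.
have [bx c3x] := beP (bend (we x c)) c3.
by rewrite bubble_ends ?c3x // bx -bubble_ends ?cx ?wx.
Qed.

(** An isomorphism with B numbers the white vertices of the bubble, and color 3 of B preserves
    numbers, so [wstep c] is read off the table of B. *)
Lemma bubble_coordinate S :
    S \in bubbles G -> bigraph_iso (bubble_graph S) octahedron ->
  exists j : white G -> 'I_4,
    [/\ forall x y, inl x \in S -> inl y \in S -> j x = j y -> x = y,
        forall i, exists2 x, inl x \in S & j x = i
      & forall x c, inl x \in S -> c != c0 ->
          j (wstep c x) = @bend octahedron (inord c.-1, j x)].
Proof.
move=> SG [f [g [h [[f' fK f'K] _ _ fgh]]]].
pose j (x : white G) := if insub x is Some u then f u else ord0.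
have jE (u : white (bubble_graph S)) : j (val u) = f u by rewrite /j valK.
have hE (u : gedge (bubble_graph S)) :
    h u = (inord (gcolor (val u)).-1, j (wend (val u))).
  have [wu _ cu] := fgh u; case: (h u) wu cu => k i /= -> <-.
  by rewrite -jE /= add0n inord_val.
exists j; split.
- move=> x y xS yS.
  have -> : x = val (exist (fun x : white G => inl x \in S) x xS) by [].
  have -> : y = val (exist (fun x : white G => inl x \in S) y yS) by [].
  by rewrite !jE => /(can_inj fK) ->.
- move=> i; have := jE (f' i); rewrite f'K; case: (f' i) => x xS jx.
  by exists x.
- move=> x c xS cn0; have [wx cx] := weP x c.
  have [bx c3x] := beP (bend (we x c)) c3.
  have eS : bubble_edge S (we x c).
    by rewrite /bubble_edge -bubble_ends ?cx ?wx ?xS ?cn0.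
  have e'S : bubble_edge S (be (bend (we x c)) c3).
    by rewrite /bubble_edge -bubble_ends ?c3x // wstep_bubble ?xS.
  (* The edges of colors [c] and 3 share a black end, hence so do their images in B. *)
  have [_ b _] := fgh (exist (bubble_edge S) _ eS).
  have [_ b' _] := fgh (exist (bubble_edge S) _ e'S).
  rewrite hE /= wx cx in b; rewrite hE /= c3x in b'.
  rewrite [RHS]b; transitivity (@bend octahedron (inord c3.-1, j (wstep c x))).
    by rewrite (@octahedron_across unit c3 (tt, _)) // across_id //; right.
  by rewrite [LHS]b'; congr g; apply: val_inj.
Qed.

Hypothesis bub : forall S, S \in bubbles G ->
  bigraph_iso (bubble_graph S) octahedron.

(** The squares of [M] are the bubbles, its edges the white vertices, placed at corners by the
    numbering of their bubble. The rotation is [wback c0] and the black vertices are its orbits. *)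
Lemma folding : exists M, foot_onto M /\ bigraph_iso G (graph_of M).
Proof.
pose square : finType := {S : {set vertex G} | S \in bubbles G}.
have /choice[J JP] (S : square) := bubble_coordinate (valP S) (bub (valP S)).
have clsP x :
    [set v | connect (adj [pred c | c != c0]) (inl x) v] \in bubbles G.
  by apply/imsetP; exists (inl x) => //; apply/setP=> v; rewrite !inE.
pose cls x : square :=
  exist (fun S : {set vertex G} => S \in bubbles G) _ (clsP x).
have cls_in x : inl x \in val (cls x) by rewrite inE connect0.
have in_cls x (S : square) : inl x \in val S -> cls x = S.
  case: S => S SG /= xS; apply: val_inj => /=.
  have [u Su] := bubble_connect SG; rewrite Su inE in xS.
  rewrite Su; apply/setP=> v; rewrite !inE.
  by symmetry; apply: same_connect => //; apply: adj_connect_sym.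
pose tip x : inner square := (cls x, J (cls x) x).
have [at_ tipK atK] : bijective tip.
  apply: inj_surj_bij => [x y xy|[S i]].
    have xy1 : cls x = cls y := congr1 fst xy.
    have [J_inj _ _] := JP (cls x); apply: J_inj; first exact: cls_in.
      by rewrite xy1.
    by rewrite {2}xy1; apply: (congr1 snd xy).
  have [_ J_onto _] := JP S; have [x xS Jx] := J_onto i.
  by exists x; rewrite /tip (in_cls x S) // Jx.
have tip_step c x : c != c0 -> tip (wstep c x) = across c (tip x).
  move=> cn0; have [_ _ Jc] := JP (cls x).
  have cxS : cls (wstep c x) = cls x.
    by apply: in_cls; rewrite wstep_bubble // (valP (cls x)).
  rewrite [RHS]surjective_pairing across_fst /tip cxS; congr (_, _).
  by rewrite Jc // (octahedron_across (cls x, _)).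
pose rot := perm (can_inj (wbackK c0)).
have foot_rot x : porbit rot x \in porbits rot by apply: imset_f.
pose foot x : {O : {set white G} | O \in porbits rot} :=
  exist (fun O : {set white G} => O \in porbits rot) _ (foot_rot x).
have rotP x y : (y \in porbit rot x) = (foot y == foot x).
  by rewrite -val_eqE /= eq_porbit_mem.
pose M := MGraph tipK atK rotP.
have stepE c x : mstep M c x = wstep c x.
  have [->|cn0] := eqVneq c c0.
    rewrite mstep0; apply: (@perm_inj _ (mrot M)).
    by rewrite permKV /= permE wstepK.
  by rewrite mstepE // /mopp /= -tip_step.
exists M; split.
  by case=> O OP; have /imsetP[x _ Ox] := OP; exists x; apply: val_inj.
(* A black vertex goes to its white neighbor along color 3. *)
exists id, (fun y => wend (be y c3)), (fun e => (wend e, gcolor e)); split.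
- by exists id.
- exists (fun x => bend (we x c3)) => [y|x].
    by have [yb cy] := beP y c3; rewrite we_wend.
  by have [wx cx] := weP x c3; rewrite be_bend.
- by exists (fun p => we p.1 p.2) => [e|[x c]] /=;
    rewrite ?weK ?(weP _ _).1 ?(weP _ _).2.
- by move=> e; split=> //=; rewrite stepE /wstep weK.
Qed.

End Folding.

Lemma octahedral_folding G : octahedral G ->
  exists M, [/\ stuffed_map M, foot_onto M & bigraph_iso G (graph_of M)].
Proof.
move=> [/colored_edges[we [be [weP beP weK beK]]] conG bubG].
have [M [onto GM]] := folding weP beP weK beK bubG.
have [U] := unfolded_iso GM; exists M; split=> //.
have [/card_gt0P[v _] _] := conG.
exact: (connected_stuffed U onto (vpos U v)).
Qed.

Lemma octahedral_graph_of M : stuffed_map M -> octahedral (graph_of M).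
Proof.
move=> sM; have [_ /card_gt0P[s _]] := sM.
have onto := stuffed_map_onto sM; have [U] := unfolded_graph_of M.
pose x0 := medge_at (s, ord0); split.
- exact: graph_of_colored.
- exact: (stuffed_connected U onto x0).
- by move=> S /(bubblesP U)[s' ->]; apply: bubble_octahedron.
Qed.

Lemma correspondence G M : foot_onto M -> medge M ->
  bigraph_iso G (graph_of M) ->
  (exists th : white G -> medge M,
     [/\ bijective th, bubbles_to_squares th, faces_to_map_faces th c1,
         faces_to_map_faces th c2 & faces_to_black_vertices th]) /\
  #|bubbles G| = #|msquare M| /\ nfaces G = mnfaces M.
Proof.
move=> onto x0 /unfolded_iso[U]; split; last first.
  by split; [apply: card_bubbles U x0 | apply: nfaces_mnfaces U onto x0].
exists (wpos U); split.
- by exists (wat U); [apply: wposK | apply: watK].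
- exact: bubbles_squares.
- exact: faces_map_faces.
- exact: faces_map_faces.
- exact: faces_black_vertices.
Qed.

(** * Isomorphism classes *)

Lemma sig_eq (T : Type) (P : T -> Prop) (u v : {x | P x}) :
  sval u = sval v -> u = v.
Proof.
by case: u v => [x px] [y py] /= xy; apply: eq_exist.
Qed.

(** Describes the image class without choosing a representative of [C]. The condition [foot_onto]
    keeps out maps with added isolated black vertices, which have the same [graph_of]. *)
Lemma folded_class (C : calG) : exists2 M, stuffed_map M &
  (fun M => foot_onto M /\ sval C (graph_of M)) = mgraph_iso M.
Proof.
case: C => C [G oG CE] /=; rewrite {}CE.
have [M [sM onto GM]] := octahedral_folding oG.
exists M => //; apply/funext=> N; apply/propext; split=> [[ontoN GN]|MN].
  apply: graph_of_iso_inv => //.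
  exact: bigraph_iso_trans (bigraph_iso_sym GM) GN.
split; first exact: foot_onto_iso MN onto.
exact: bigraph_iso_trans GM (graph_of_iso MN).
Qed.

Lemma unfolded_class (D : calM) : exists2 G, octahedral G &
  (fun G => exists2 M, sval D M & bigraph_iso (graph_of M) G) = bigraph_iso G.
Proof.
case: D => D [M sM DE] /=; rewrite {}DE; exists (graph_of M).
  exact: octahedral_graph_of.
apply/funext=> G; apply/propext; split=> [[N MN NG]|MG].
  exact: bigraph_iso_trans (graph_of_iso MN) NG.
by exists M => //; apply: mgraph_iso_refl.
Qed.

Definition fold_class (C : calG) : calM := exist _ _ (folded_class C).
Definition unfold_class (D : calM) : calG := exist _ _ (unfolded_class D).

Lemma fold_classK : cancel fold_class unfold_class.
Proof.
move=> C; apply: sig_eq => /=; apply/funext=> H; apply/propext.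
case: C => C [G oG CE] /=; rewrite {}CE; split=> [[M [onto GM] MH]|GH].
  exact: bigraph_iso_trans GM MH.
have [M [_ onto GM]] := octahedral_folding oG; exists M => //.
exact: bigraph_iso_trans (bigraph_iso_sym GM) GH.
Qed.

(** Maps without isolated black vertices and with isomorphic graphs are isomorphic, by
    [graph_of_iso_inv]. *)
Lemma unfold_classK : cancel unfold_class fold_class.
Proof.
move=> D; apply: sig_eq => /=; apply/funext=> N; apply/propext.
case: D => D [M sM DE] /=; rewrite {}DE; split=> [[onto [P MP PN]]|MN].
  apply: (mgraph_iso_trans MP); apply: graph_of_iso_inv PN => //.
  exact: foot_onto_iso MP (stuffed_map_onto sM).
split; first exact: foot_onto_iso MN (stuffed_map_onto sM).
by exists N => //; apply: bigraph_iso_refl.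
Qed.

Theorem theorem1 :
  exists Phi : calG -> calM,
    bijective Phi /\
    forall (C : calG) (G : bigraph) (M : mgraph),
      sval C G -> sval (Phi C) M ->
      (exists th : white G -> medge M,
         [/\ bijective th,
             bubbles_to_squares th,
             faces_to_map_faces th c1,
             faces_to_map_faces th c2
           & faces_to_black_vertices th]) /\
      #|bubbles G| = #|msquare M| /\
      nfaces G = mnfaces M.
Proof.
exists fold_class; split.
  by exists unfold_class; [apply: fold_classK | apply: unfold_classK].
(* Membership of [M] in [fold_class C] unfolds to [foot_onto M] and [graph_of M] lying in [C], so
   [G] and [graph_of M] are both isomorphic to the representative [G0]. *)
move=> C G M CG [onto]; case: C CG => C [G0 [_ con0 _] CE] /=.
rewrite {}CE => G0G G0M.
have [U] := unfolded_iso G0M.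
have [/card_gt0P[v _] _] := con0.
apply: correspondence => //; first exact: (vpos U v).
exact: bigraph_iso_trans (bigraph_iso_sym G0G) G0M.
Qed.
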